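(* Let $q$ be a prime power and let $\Psi \in Aut(\overrightarrow{\Gamma_{l-i}}(M_2(F_q)))$. Then there exists a permutation $\rho$ of $M_2(F_q)$ that maps $R_i$ onto $R_i$ for each $i = 0,1,2$, such that $\rho = \Psi$ (that is, every automorphism $\Psi$ is a permutation of $M_2(F_q)$ that permutes the elements of each $R_i$ among themselves).
   Context: $F_q$ is the finite field with $q$ elements and $M_2(F_q)$ is the ring of all $2\times 2$ matrices over $F_q$. For $i=0,1,2$, $R_i = \{X \in M_2(F_q) : rank(X) = i\}$. For $X \in M_2(F_q)$, $[X] = \{AX : A \in M_2(F_q)\}$ is the left ideal generated by $X$. The left-ideal relation graph $\overrightarrow{\Gamma_{l-i}}(M_2(F_q))$ is the directed graph with vertex set $M_2(F_q)$ and a directed edge $X \rightarrow Y$ if and only if $[X]$ is properly contained in $[Y]$. An automorphism of a directed graph is a permutation $f$ of its vertex set such that $f(u) \rightarrow f(v)$ if and only if $u \rightarrow v$; $Aut$ denotes the group of automorphisms. *)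

(* Defs.v *)
From mathcomp Require Import all_boot all_order all_algebra all_fingroup.

Set Implicit Arguments.
Unset Strict Implicit.
Unset Printing Implicit Defensive.

Import GroupScope GRing.Theory.
Local Open Scope ring_scope.

(* A directed graph on a finite vertex type is given by its edge relation. *)
Section DigraphAut.
Variables (T : finType) (e : rel T).

Definition digraph_aut : {set {perm T}} :=
  [set f : {perm T} | [forall u, forall v, e (f u) (f v) == e u v]].

Lemma digraph_autP (f : {perm T}) :
  reflect (forall u v, e (f u) (f v) = e u v) (f \in digraph_aut).
Proof.
rewrite inE; apply: (iffP forallP) => [h u v|h u].
  by have /forallP/(_ v)/eqP := h u.
by apply/forallP => v; rewrite h.
Qed.

Lemma digraph_aut_group_set : group_set digraph_aut.
Proof.
apply/group_setP; split=> [|f g /digraph_autP hf /digraph_autP hg].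
  by apply/digraph_autP => u v; rewrite !perm1.
by apply/digraph_autP => u v; rewrite !permM hg hf.
Qed.

Canonical digraph_aut_group := Group digraph_aut_group_set.

End DigraphAut.

Section LeftIdealGraph.
Variable F : finFieldType.

Definition left_ideal (X : 'M[F]_2) : {set 'M[F]_2} :=
  [set A *m X | A : 'M[F]_2].

Definition left_ideal_edge : rel 'M[F]_2 :=
  [rel X Y | left_ideal X \proper left_ideal Y].

Definition rank_class (i : nat) : {set 'M[F]_2} :=
  [set X : 'M[F]_2 | \rank X == i].

End LeftIdealGraph.

(* Main.v *)
Require Import Defs.
From mathcomp Require Import all_boot all_order all_algebra all_fingroup.

(** The edge [X -> Y] is strict inclusion of row spaces, so the matrices of rank
    0 are exactly the vertices without predecessor and those of rank 2 exactly
    the vertices without successor; the rank of a vertex can therefore be read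
    off the graph, and every automorphism preserves it. *)

(** Since [X] lies in its own ideal, inclusion amounts to [X] being a left multiple of [Y]. *)
Lemma left_ideal_subset (F : finFieldType) (X Y : 'M[F]_2) :
  (left_ideal X \subset left_ideal Y) = (X <= Y)%MS.
Proof.
apply/subsetP/submxP => [sXY | [D ->] _ /imsetP[A _ ->]].
- have /sXY/imsetP[D _ ->] : X \in left_ideal X.
    by apply/imsetP; exists (1%:M)%R; rewrite ?mul1mx.
  by exists D.
- by rewrite mulmxA; apply: imset_f.
Qed.

Lemma left_ideal_edgeE (F : finFieldType) (X Y : 'M[F]_2) :
  left_ideal_edge X Y = (X < Y)%MS.
Proof.
by rewrite -[LHS]/(left_ideal X \proper left_ideal Y) properE !left_ideal_subset.
Qed.

Lemma has_predecessorE (F : finFieldType) (X : 'M[F]_2) :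
  [exists U, left_ideal_edge U X] = (0 < \rank X)%N.
Proof.
apply/existsP/idP => [[U] | X_gt0].
- by rewrite left_ideal_edgeE ltmxErank => /andP[_]; apply: leq_trans.
(* The zero ideal lies strictly below every nonzero one. *)
- by exists 0%R; rewrite left_ideal_edgeE lt0mx -mxrank_eq0 -lt0n.
Qed.

Lemma has_successorE (F : finFieldType) (X : 'M[F]_2) :
  [exists V, left_ideal_edge X V] = (\rank X < 2)%N.
Proof.
apply/existsP/idP => [[V] | X_lt2].
- rewrite left_ideal_edgeE ltmxErank => /andP[_ ltXV].
  exact: leq_trans ltXV (rank_leq_row V).
- by exists (1%:M)%R; rewrite left_ideal_edgeE ltmx1 /row_full neq_ltn X_lt2.
Qed.

(** The rank is at most 2, so it is the sum of the indicators of rank at least 1 and rank at least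
    2. *)
Lemma mxrank_graphE (F : finFieldType) (X : 'M[F]_2) :
  \rank X = ([exists U, left_ideal_edge U X]
             + ~~ [exists V, left_ideal_edge X V])%N.
Proof.
rewrite has_predecessorE has_successorE.
by have := rank_leq_row X; case: (\rank X) => [|[|[|r]]].
Qed.

Lemma digraph_aut_mxrank (F : finFieldType) (Psi : {perm 'M[F]_2}) :
  Psi \in digraph_aut (@left_ideal_edge F) ->
  forall X, \rank (Psi X) = \rank X.
Proof.
move=> /digraph_autP edgePsi X; rewrite !mxrank_graphE; congr (nat_of_bool _ + ~~ _)%N.
(* Neighbours of [X] are pushed forward by [Psi]; those of [Psi X] are pulled back by its
   inverse. *)
- apply/existsP/existsP => -[U UX]; last by exists (Psi U); rewrite edgePsi.
  by exists ((Psi^-1)%g U); rewrite -edgePsi permKV.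
- apply/existsP/existsP => -[V XV]; last by exists (Psi V); rewrite edgePsi.
  by exists ((Psi^-1)%g V); rewrite -edgePsi permKV.
Qed.

Theorem theorem3p28 (q : nat)
    (hq : exists p k : nat, [/\ prime p, (0 < k)%N & q = (p ^ k)%N])
    (F : finFieldType) (hF : #|F| = q)
    (Psi : {perm 'M[F]_2})
    (hPsi : Psi \in digraph_aut (@left_ideal_edge F)) :
  exists rho : {perm 'M[F]_2},
    (forall i : nat, (i <= 2)%N -> rho @: rank_class F i = rank_class F i) /\
    rho = Psi.
Proof.
exists Psi; split=> // i _; apply/eqP.
(* By injectivity the image has the cardinality of the class, so one inclusion suffices. *)
rewrite eqEcard card_imset ?leqnn ?andbT; last exact: perm_inj.
by apply/subsetP => _ /imsetP[X + ->]; rewrite !inE digraph_aut_mxrank.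
Qed.
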